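(* Let $(E,\mathcal{E})$ be a countably generated measurable space whose diagonal $\Delta=\{(x,x): x\in E\}$ belongs to $\mathcal{E}\otimes\mathcal{E}$, and let $X=(X_n)_{n\in\mathbb{Z}_+}$ be a Markov chain with state space $(E,\mathcal{E})$ and $n$-step transition probabilities $P_n(x,dy)$. Assume that for each $x,y\in E$ there exists $n=n_{x,y}\in\mathbb{N}$ such that $$P_n(x,\cdot)\not\perp P_n(y,\cdot).$$ Then there exists at most one invariant probability measure for the chain $X$. If an invariant probability measure $\mu$ exists, then for $\mu$-almost all $x\in E$ $$\|P_n(x,\cdot)-\mu\|\to 0,\quad n\to\infty.$$
   Context: The Markov chain is time-homogeneous in discrete time; $P(x,dy)$ denotes its one-step transition probability (a Markov kernel on $(E,\mathcal{E})$) and $P_n(x,dy)$ its $n$-step transition probability. An invariant probability measure for $X$ is a probability measure $\mu$ on $(E,\mathcal{E})$ with $\mu(dy)=\int_E P(x,dy)\,\mu(dx)$. Probability measures $\nu,\bar\nu$ on $(E,\mathcal{E})$ are singular ($\nu\perp\bar\nu$) if there exists $A\in\mathcal{E}$ with $\nu(A)=1$ and $\bar\nu(A)=0$; otherwise they are non-singular ($\nu\not\perp\bar\nu$). $\|\nu-\bar\nu\|$ is the total variation of the signed measure $\nu-\bar\nu$ (so it takes values in $[0,2]$, with value $2$ exactly when $\nu\perp\bar\nu$). *)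

(* Defs.v *)
From HB Require Import structures.
From mathcomp Require Import all_boot all_order all_algebra.
From mathcomp Require Import all_classical all_reals all_analysis.

Set Implicit Arguments.
Unset Strict Implicit.
Unset Printing Implicit Defensive.

Import Order.TTheory GRing.Theory Num.Theory.
Import numFieldNormedType.Exports.

Local Open Scope classical_set_scope.
Local Open Scope ring_scope.
Local Open Scope ereal_scope.

Definition countably_generated d (E : measurableType d) : Prop :=
  exists G : set (set E), countable G /\ measurable = <<s G >>.

Definition singular d (E : measurableType d) (R : realType)
    (nu nu' : probability E R) : Prop :=
  exists A, [/\ measurable A, nu A = 1 & nu' A = 0].

Section total_variation_norm.
Context d (E : measurableType d) (R : realType).

(* `|sigma|(E)`, where `|sigma| = sigma^+ + sigma^-`; the Hahn decomposition is
   chosen arbitrarily, see `total_variation_normE`. *)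
Definition total_variation_norm (sigma : {charge set E -> \bar R}) : \bar R :=
  let PN := cid (Hahn_decomposition sigma) in
  let N := cid (svalP PN) in
  charge_variation (svalP N) [set: E].

Lemma total_variation_normE (sigma : {charge set E -> \bar R}) P N
    (PN : hahn_decomposition sigma P N) :
  total_variation_norm sigma = charge_variation PN [set: E].
Proof.
rewrite /total_variation_norm; case: cid => P' /= PP'; case: cid => N' /= PN'.
have [e1 e2] := Hahn_decomposition_uniq PN' PN measurableT.
rewrite /charge_variation !jordan_posE !jordan_negE.
by rewrite !cjordan_posE !cjordan_negE /crestr0 !mem_set// /crestr e1 e2.
Qed.

Definition measure_diff (nu nu' : {finite_measure set E -> \bar R}) :
    {charge set E -> \bar R} :=
  cadd (charge_of_finite_measure nu) (copp (charge_of_finite_measure nu')).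

End total_variation_norm.

Section kcomp_noparam_probability.
Context d0 d1 d2 (T0 : measurableType d0) (T1 : measurableType d1)
  (T2 : measurableType d2) (R : realType)
  (k1 : R.-pker T0 ~> T1) (k2 : R.-pker T1 ~> T2).

Let mkcomp_noparam_prob x : mkcomp_noparam k1 k2 x [set: T2] = 1.
Proof.
rewrite /mkcomp_noparam /= /kcomp_noparam.
under eq_integral do rewrite prob_kernel.
by rewrite integral_cst// mul1e prob_kernel.
Qed.

HB.instance Definition _ := isProbabilityKernel.Build _ _ _ _ _
  (mkcomp_noparam k1 k2) mkcomp_noparam_prob.

End kcomp_noparam_probability.

Section transition_probability.
Context d (E : measurableType d) (R : realType) (P : R.-pker E ~> E).

(* `P_0(x, .)` is the Dirac mass at `x` and
   `P_{n+1}(x, A) = \int P(y, A) P_n(x, dy)`. *)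
Fixpoint nstep (n : nat) : R.-pker E ~> E :=
  match n with
  | O => kdirac (@measurable_id _ E [set: E])
  | n'.+1 => mkcomp_noparam (nstep n') P
  end.

(* the name `nstep_prob` carries the canonical `probability E R` structure of
   `nstep n x` *)
Definition nstep_prob (n : nat) (x : E) : set E -> \bar R := nstep n x.

HB.instance Definition _ n x := Measure.on (nstep_prob n x).

Let nstep_prob_setT n x : nstep_prob n x [set: E] = 1.
Proof. exact: prob_kernel. Qed.

HB.instance Definition _ n x :=
  Measure_isProbability.Build _ _ _ (nstep_prob n x) (nstep_prob_setT n x).

Definition invariant_probability (mu : probability E R) : Prop :=
  forall A, measurable A -> mu A = \int[mu]_x P x A.

End transition_probability.

(* Main.v *)
(**
  Let d_n(x,y) be the total variation distance (with values in [0,1]) between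
  P_n(x,.) and P_n(y,.); it is nonincreasing in n, and its limit d is measurable
  because E is countably generated.

  Running two independent copies of the chain shows that d is subinvariant
  under the product kernels P_n x P_n.  If mu and mu' are invariant,
  mu \x mu' is invariant for these kernels, so subinvariance of the bounded
  function d forces d to be constant, equal to c = d(x,y), almost everywhere for
  P_n(x,.) \x P_n(y,.), for almost every (x,y) and every n.

  Choose n with r = d_n(x,y) < 1, and couple P_n(x,.) and P_n(y,.) by keeping
  their common part on the diagonal and making the residual parts, of mass r,
  independent.  Only the residual parts contribute, so r c <= r^2 c, whence
  c = 0.  Thus d = 0 almost everywhere for mu \x mu', and both claims follow by
  integrating d_n and letting n tend to infinity.
*)

Require Import Defs.
From HB Require Import structures.
From mathcomp Require Import all_boot all_order all_algebra.
From mathcomp Require Import all_classical all_reals all_analysis.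
From mathcomp Require Import measurable_realfun ring lra.

Set Implicit Arguments.
Unset Strict Implicit.
Unset Printing Implicit Defensive.

Import Order.TTheory GRing.Theory Num.Theory.
Import numFieldNormedType.Exports.
Local Open Scope classical_set_scope.
Local Open Scope ring_scope.
Local Open Scope ereal_scope.

(** * Approximation of measurable sets by a countable algebra *)

(* Coding boolean combinations of the [G n] by trees, a countable type, makes
   the algebra they generate countable. *)
Fixpoint set_of_tree {T : Type} (G : nat -> set T) (t : GenTree.tree nat) :
    set T :=
  match t with
  | GenTree.Leaf n => G n
  | GenTree.Node 0 [:: t1] => ~` set_of_tree G t1
  | GenTree.Node _ [:: t1; t2] => set_of_tree G t1 `|` set_of_tree G t2
  | _ => set0
  end.

Lemma measurable_set_of_tree d (E : measurableType d) (G : nat -> set E) :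
  (forall n, measurable (G n)) -> forall t, measurable (set_of_tree G t).
Proof.
move=> mG; fix IH 1 => -[n|[|n] [|t1 [|t2 [|t3 s]]]] //=;
  try exact: measurable0.
- exact: measurableC.
- exact: measurableU.
- exact: measurableU.
Qed.

Section approximation.
Context d (E : measurableType d) (R : realType) (m : {measure set E -> \bar R}).
Variable C : set (set E).
Hypotheses (mfin : m [set: E] < +oo) (mC : C `<=` measurable)
  (C0 : C set0) (CC : forall A, C A -> C (~` A))
  (CU : forall A B, C A -> C B -> C (A `|` B)).

Let approx (B : set E) := measurable B /\
  forall e : R, (0 < e)%R -> exists2 A, C A & m (B `+` A) < e%:E.

Let mY (X Y : set E) : measurable X -> measurable Y -> measurable (X `+` Y).
Proof.
by move=> mX mY; rewrite setY_def; apply: measurableU; exact: measurableD.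
Qed.

Let approxU A B : approx A -> approx B -> approx (A `|` B).
Proof.
move=> [mA hA] [mB hB]; split; first exact: measurableU.
move=> e e0; have e20 : (0 < e / 2)%R by rewrite divr_gt0.
have [A' CA' lA] := hA _ e20; have [B' CB' lB] := hB _ e20.
exists (A' `|` B'); first exact: CU.
have mA' := mC CA'; have mB' := mC CB'.
apply: (@le_lt_trans _ _ (m ((A `+` A') `|` (B `+` B')))).
  apply: le_measure; rewrite ?inE.
  - by apply: mY; exact: measurableU.
  - by apply: measurableU; exact: mY.
  - move=> x /=; tauto.
apply: (le_lt_trans (measureU2 _ (mY mA mA') (mY mB mB'))).
by rewrite [e]splitr EFinD lteD.
Qed.

Let approxC A : approx A -> approx (~` A).
Proof.
move=> [mA hA]; split; first exact: measurableC.
move=> e e0; have [A' CA' lA] := hA _ e0.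
exists (~` A'); first exact: CC.
rewrite (_ : _ `+` _ = A `+` A')//.
apply/seteqP; split => x /=;
  have [?|?] := pselect (A x); have [?|?] := pselect (A' x); tauto.
Qed.

Let approx_bigcup (F : (set E)^nat) :
  (forall n, approx (F n)) -> approx (\bigcup_n F n).
Proof.
move=> hF; have mF n : measurable (F n) by case: (hF n).
split; first exact: bigcupT_measurable.
pose U n := \big[setU/set0]_(i < n.+1) F i.
have aU n : approx (U n).
  rewrite /U; elim: n => [|n IH]; last by rewrite big_ord_recr; exact: approxU.
  by rewrite big_ord_recr big_ord0 /= set0U.
have mU n : measurable (U n) by case: (aU n).
have UF : \bigcup_n U n = \bigcup_n F n by exact: bigcup_bigsetU_bigcup.
move=> e e0; have e20 : (0 < e / 2)%R by rewrite divr_gt0.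
(* Half of the error goes to replacing the union by a partial union, through continuity from above;
   the other half to approximating that partial union by a set of [C]. *)
have [n Hn] : exists n, m (\bigcup_n F n `\` U n) < (e / 2)%:E.
  have mD k : measurable (\bigcup_n F n `\` U k).
    by apply: measurableD => //; exact: bigcupT_measurable.
  have h : (m \o (fun k => \bigcup_n F n `\` U k)) @ \oo -->
           m (\bigcap_k (\bigcup_n F n `\` U k)).
    apply: nonincreasing_cvg_mu => //.
    - by apply: le_lt_trans mfin; apply: le_measure; rewrite ?inE.
    - exact: bigcapT_measurable.
    - move=> i j ij; apply/subsetPset; apply: setDS.
      by apply: subset_bigsetU.
  have e0' : \bigcap_k (\bigcup_n F n `\` U k) = set0.
    apply/seteqP; split => // x /= h'.
    have [xF _] := h' 0%N I; rewrite -UF in xF; case: xF => k _ xk.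
    by have [_] := h' k I; exact.
  rewrite e0' measure0 in h.
  have : \forall k \near \oo,
      (m \o (fun k => \bigcup_n F n `\` U k)) k < (e / 2)%:E.
    move/fine_cvgP : h => [hfin h].
    move/cvgrPdist_lt : h => /(_ _ e20) h.
    near=> k.
    have f1 : (m \o (fun k => \bigcup_n F n `\` U k)) k \is a fin_num.
      by near: k.
    have : (`|0 - fine ((m \o (fun k => \bigcup_n F n `\` U k)) k)| < e / 2)%R.
      by near: k.
    rewrite sub0r normrN => h1; rewrite -(fineK f1) lte_fin.
    exact: le_lt_trans (ler_norm _) h1.
  by case=> k _ /(_ k (leqnn k)) ?; exists k.
have [A CA lA] := (aU n).2 _ e20.
exists A => //; have mA := mC CA.
have mFU : measurable (\bigcup_n F n) by exact: bigcupT_measurable.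
apply: (@le_lt_trans _ _ (m ((\bigcup_n F n `\` U n) `|` (U n `+` A)))).
  apply: le_measure; rewrite ?inE.
  - exact: mY.
  - by apply: measurableU; [exact: measurableD|exact: mY].
  - have UFn : U n `<=` \bigcup_n F n by rewrite -UF; exact: bigcup_sup.
    move=> x /= h; have := UFn x; have [?|?] := pselect (U n x); tauto.
apply: (le_lt_trans (measureU2 _ (measurableD mFU (mU n)) (mY (mU n) mA))).
by rewrite [e]splitr EFinD lteD.
Unshelve. all: by end_near. Qed.

(** The approximable sets contain [C] and form a sigma-algebra: complements have the same symmetric
    difference, errors add up under finite unions, and countable unions reduce to finite ones
    because [m] is finite. *)
Lemma algebra_dense : measurable = <<s C >> ->
  forall B, measurable B -> forall e : R, (0 < e)%R ->
  exists2 A, C A & m (B `+` A) < e%:E.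
Proof.
move=> mE B mB; suff : approx B by case.
have : <<s C >> B by rewrite -mE.
apply: smallest_sub.
  split.
  - split => // e e0; exists set0 => //; by rewrite setY0 measure0 lte_fin.
  - by move=> A; rewrite setTD; exact: approxC.
  - exact: approx_bigcup.
move=> A CA; split; first exact: mC.
by move=> e e0; exists A => //; rewrite setYK measure0 lte_fin.
Qed.

End approximation.

(** The sequence [A] is chosen before [m], so one sequence serves all the laws [nstep P n x]; this
    later makes suprema over measurable sets measurable in the starting points. *)
Lemma countably_generated_dense d (E : measurableType d) (R : realType) :
  countably_generated E ->
  exists A : nat -> set E, (forall k, measurable (A k)) /\
    forall m : {measure set E -> \bar R}, m [set: E] < +oo ->
    forall B, measurable B -> forall e : R, (0 < e)%R ->
    exists k, m (B `+` A k) < e%:E.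
Proof.
move=> [G [/pcard_leP[f] mG]].
have GE : G `<=` measurable by rewrite mG; exact: sub_gen_smallest.
have [g gG Gg] : exists2 g : nat -> set E, (forall n, measurable (g n)) &
    forall A, G A -> exists n, g n = A.
  (* [f] injects [G] into the naturals; [g n] is the member of [G] with code [n], or [set0] if there
     is none. *)
  exists (fun n => xget set0 [set A | G A /\ f A = n]).
    move=> n; case: xgetP => [A _ [/GE//]|_]; exact: measurable0.
  move=> A GA; exists (f A); case: xgetP => [B _ [GB fBA]|].
    by apply: (@inj _ _ _ f) fBA; rewrite inE.
  by move=> /(_ A) /= h; exfalso; apply: h.
exists (fun k => if unpickle k is Some t then set_of_tree g t else set0); split.
  by move=> k; case: unpickle => [t|//]; exact: measurable_set_of_tree.
move=> m mfin B mB e e0.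
have [|||||A [t _ <-] lA] :=
  @algebra_dense _ E R m (range (set_of_tree g)) mfin _ _ _ _ _ B mB e e0.
- by move=> _ [t _ <-]; exact: measurable_set_of_tree.
- by exists (GenTree.Node 0 [::]).
- by move=> _ [t _ <-]; exists (GenTree.Node 0 [:: t]).
- by move=> _ _ [t1 _ <-] [t2 _ <-]; exists (GenTree.Node 0 [:: t1; t2]).
- apply/seteqP; split.
    rewrite mG; apply: smallest_sub; first exact: smallest_sigma_algebra.
    move=> A /Gg[n <-]; apply: sub_gen_smallest.
    by exists (GenTree.Leaf n).
  apply: smallest_sub; first exact: sigma_algebra_measurable.
  by move=> _ [t _ <-]; exact: measurable_set_of_tree.
- by exists (pickle t); rewrite pickleK.
Qed.

(** * Total variation distance between probability measures *)

(** Both measures have mass one, so complementation flips the sign of a difference; this one-sided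
    supremum is therefore half of the total variation norm and lies in [0,1]. *)
Definition tv_dist d (E : measurableType d) (R : realType)
    (nu nu' : probability E R) : R :=
  sup [set (fine (nu A) - fine (nu' A))%R | A in measurable].

Section tv_dist.
Context d (E : measurableType d) (R : realType).
Implicit Types nu : probability E R.

Lemma fine_probability_itv nu A :
  measurable A -> (0 <= fine (nu A) <= 1)%R.
Proof.
move=> mA; rewrite fine_ge0//= -lee_fin fineK ?fin_num_measure//.
exact: probability_le1.
Qed.

Lemma tv_dist_has_sup nu nu' :
  has_sup [set (fine (nu A) - fine (nu' A))%R | A in measurable].
Proof.
split; first by exists (fine (nu set0) - fine (nu' set0))%R, set0.
exists 1%R => _ [A mA <-].
have /andP[_ h1] := fine_probability_itv nu mA.
have /andP[h2 _] := fine_probability_itv nu' mA.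
lra.
Qed.

Lemma tv_dist_ub nu nu' A : measurable A ->
  (fine (nu A) - fine (nu' A) <= tv_dist nu nu')%R.
Proof.
by move=> mA; apply: ub_le_sup; [case: (tv_dist_has_sup nu nu')|exists A].
Qed.

Lemma tv_dist_le nu nu' b :
  (forall A, measurable A -> fine (nu A) - fine (nu' A) <= b)%R ->
  (tv_dist nu nu' <= b)%R.
Proof.
move=> h; apply: ge_sup; first by case: (tv_dist_has_sup nu nu').
by move=> _ [A mA <-]; exact: h.
Qed.

Lemma tv_dist_ge0 nu nu' : (0 <= tv_dist nu nu')%R.
Proof. by have := @tv_dist_ub nu nu' _ measurable0; rewrite !measure0 subrr. Qed.

Lemma tv_dist_le1 nu nu' : (tv_dist nu nu' <= 1)%R.
Proof.
apply: tv_dist_le => A mA.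
have /andP[_ h1] := fine_probability_itv nu mA.
have /andP[h2 _] := fine_probability_itv nu' mA.
lra.
Qed.

(** A set of the sequence that is close to [B] for the sum of [nu] and [nu'] is close for both, and
    replacing [B] by it changes the difference by less than [e]. *)
Lemma tv_dist_dense nu nu' (A : nat -> set E) :
  (forall k, measurable (A k)) ->
  (forall m : {measure set E -> \bar R}, m [set: E] < +oo ->
    forall B, measurable B -> forall e : R, (0 < e)%R ->
    exists k, m (B `+` A k) < e%:E) ->
  tv_dist nu nu' = sup (range (fun k => fine (nu (A k)) - fine (nu' (A k))))%R.
Proof.
move=> mA dA; apply/eqP; rewrite eq_le; apply/andP; split; last first.
  apply: ge_sup; first by exists (fine (nu (A 0%N)) - fine (nu' (A 0%N)))%R, 0%N.
  by move=> _ [k _ <-]; exact: tv_dist_ub.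
apply: tv_dist_le => B mB; apply/ler_addgt0Pr => e e0.
have mfin : measure_add nu nu' [set: E] < +oo.
  rewrite measure_addE -[X in X + _]/(nu [set: E]) -[X in _ + X]/(nu' [set: E]).
  by rewrite !probability_setT -EFinD ltry.
have [k] := dA _ mfin _ mB _ e0.
rewrite [X in X < _](_ : _ = nu (B `+` A k) + nu' (B `+` A k));
  last exact: measure_addE.
move=> hk.
apply: (@le_trans _ _ (fine (nu (A k)) - fine (nu' (A k)) + e)%R); last first.
  rewrite lerD2r; apply: ub_le_sup; last by exists k.
  exists 1%R => _ [j _ <-]; apply: le_trans (tv_dist_le1 nu nu').
  exact: tv_dist_ub.
have mD : measurable (B `+` A k).
  by rewrite setY_def; apply: measurableU; exact: measurableD.
have hs (m : probability E R) X Y : measurable X -> measurable Y ->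
    (fine (m X) <= fine (m Y) + fine (m (X `\` Y)))%R.
  move=> mX mY.
  have mXY : measurable (X `\` Y) by exact: measurableD.
  rewrite -lee_fin EFinD !fineK ?fin_num_measure//.
  apply: le_trans (measureU2 _ mY mXY).
  apply: le_measure; rewrite ?inE//; first exact: measurableU.
  by move=> x /=; have [?|?] := pselect (Y x); tauto.
have ht (m : probability E R) X : measurable X -> X `<=` B `+` A k ->
    (fine (m X) <= fine (m (B `+` A k)))%R.
  move=> mX XY; apply: fine_le; rewrite ?fin_num_measure//.
  by apply: le_measure; rewrite ?inE.
have {}hk : (fine (nu (B `+` A k)) + fine (nu' (B `+` A k)) < e)%R.
  by rewrite -lte_fin EFinD !fineK ?fin_num_measure.
have := hs nu _ _ mB (mA k); have := hs nu' _ _ (mA k) mB.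
have := ht nu (B `\` A k) (measurableD mB (mA k)) (@subsetUl _ _ _).
have := ht nu' (A k `\` B) (measurableD (mA k) mB) (@subsetUr _ _ _).
lra.
Qed.

Lemma fine_probability_setIC nu A B : measurable A -> measurable B ->
  fine (nu A) = (fine (nu (A `&` ~` B)) + fine (nu (A `&` B)))%R.
Proof.
move=> mA mB; have mC := measurableC mB.
have m1 : measurable (A `&` ~` B) by exact: measurableI.
have m2 : measurable (A `&` B) by exact: measurableI.
rewrite -fineD ?fin_num_measure// -measureU//.
  by rewrite -setIUr setUC setUv setIT.
by rewrite setIACA setICl setI0.
Qed.

Lemma hahn_decomposition_setC (sigma : {charge set E -> \bar R}) Ps N :
  hahn_decomposition sigma Ps N -> N = ~` Ps.
Proof.
move=> [_ _ PNT PN0]; apply/seteqP; split => x.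
  by move=> Nx Px; have : (Ps `&` N) x by []; rewrite PN0.
by move=> nPx; have [|] : (Ps `|` N) x by rewrite PNT.
Qed.

Section hahn_decomposition.
Variables (nu nu' : probability E R) (Ps N : set E).
Hypothesis HPN : hahn_decomposition (measure_diff nu nu') Ps N.

Let mP : measurable Ps. Proof. by case: HPN => -[]. Qed.
Let mN : measurable N. Proof. by case: HPN => _ []. Qed.
Let NE : N = ~` Ps := hahn_decomposition_setC HPN.

Let pos A : measurable A -> A `<=` Ps -> (fine (nu' A) <= fine (nu A))%R.
Proof.
have [[_ posP] _ _ _] := HPN => mA /(posP _ mA).
by rewrite -subr_ge0 -lee_fin EFinB !fineK ?fin_num_measure.
Qed.

Let neg A : measurable A -> A `<=` N -> (fine (nu A) <= fine (nu' A))%R.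
Proof.
have [_ [_ negN] _ _] := HPN => mA /(negN _ mA).
by rewrite -subr_le0 -lee_fin EFinB !fineK ?fin_num_measure.
Qed.

(** Passing from [A] to [Ps] drops the part of [A] outside [Ps], where the difference is
    nonpositive, and adds the part of [Ps] outside [A], where it is nonnegative. *)
Lemma tv_dist_hahn : tv_dist nu nu' = (fine (nu Ps) - fine (nu' Ps))%R.
Proof.
apply/eqP; rewrite eq_le tv_dist_ub// andbT; apply: tv_dist_le => A mA.
have mAP : measurable (A `&` Ps) by exact: measurableI.
have mAN : measurable (A `&` ~` Ps) by rewrite -NE; exact: measurableI.
have mPA : measurable (Ps `&` ~` A).
  by apply: measurableI => //; exact: measurableC.
have h1 : (fine (nu (A `&` ~` Ps)) <= fine (nu' (A `&` ~` Ps)))%R.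
  by apply: neg => //; rewrite NE; exact: subIsetr.
have h2 := pos mPA (@subIsetl _ _ _).
move: (fine_probability_setIC nu mA mP) (fine_probability_setIC nu' mA mP).
move: (fine_probability_setIC nu mP mA) (fine_probability_setIC nu' mP mA).
rewrite [Ps `&` A]setIC; lra.
Qed.

Lemma jordan_pos_measure_diff A : measurable A ->
  jordan_pos HPN A = (fine (nu (A `&` Ps)) - fine (nu' (A `&` Ps)))%:E.
Proof.
move=> mA; rewrite jordan_posE cjordan_posE /crestr0 mem_set// /crestr.
rewrite (_ : measure_diff _ _ _ = nu (A `&` Ps) - nu' (A `&` Ps))//.
by rewrite EFinB !fineK// fin_num_measure//; exact: measurableI.
Qed.

Lemma jordan_neg_measure_diff A : measurable A ->
  jordan_neg HPN A = (fine (nu' (A `&` N)) - fine (nu (A `&` N)))%:E.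
Proof.
move=> mA; rewrite jordan_negE cjordan_negE /crestr0 mem_set// /crestr.
rewrite (_ : measure_diff _ _ _ = nu (A `&` N) - nu' (A `&` N))//.
have mAN : measurable (A `&` N) by exact: measurableI.
rewrite -[X in X - _]fineK ?fin_num_measure//.
rewrite -[X in _ - X]fineK ?fin_num_measure//.
by rewrite -EFinB -EFinN opprB.
Qed.

Lemma jordan_pos_tv_dist : jordan_pos HPN [set: E] = (tv_dist nu nu')%:E.
Proof. by rewrite jordan_pos_measure_diff// setTI tv_dist_hahn. Qed.

Lemma jordan_neg_tv_dist : jordan_neg HPN [set: E] = (tv_dist nu nu')%:E.
Proof.
rewrite jordan_neg_measure_diff// setTI tv_dist_hahn NE !probability_setC//.
by rewrite !fineB ?fin_num_measure//=; congr EFin; lra.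
Qed.

End hahn_decomposition.

Lemma total_variation_norm_tv_dist nu nu' :
  total_variation_norm (measure_diff nu nu') = (2 * tv_dist nu nu')%:E.
Proof.
have [Ps [N HPN]] := Hahn_decomposition (measure_diff nu nu').
rewrite (total_variation_normE HPN) /charge_variation.
by rewrite jordan_pos_tv_dist jordan_neg_tv_dist -EFinD; congr EFin; lra.
Qed.

(** The positive set of a Hahn decomposition witnesses singularity: two numbers in [0,1] whose
    difference is 1 are 1 and 0. *)
Lemma singular_tv_dist nu nu' : tv_dist nu nu' = 1%R -> singular nu nu'.
Proof.
have [Ps [N HPN]] := Hahn_decomposition (measure_diff nu nu').
have mP : measurable Ps by case: HPN => -[].
rewrite (tv_dist_hahn HPN) => h; exists Ps.
have /andP[? ?] := fine_probability_itv nu mP.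
have /andP[? ?] := fine_probability_itv nu' mP.
split => //.
- by rewrite -(fineK (fin_num_measure nu _ mP)); congr EFin; lra.
- by rewrite -(fineK (fin_num_measure nu' _ mP)); congr EFin; lra.
Qed.

(** Maximal coupling: [k] is the minimum of the two measures, that is, [nu] on the negative set plus
    [nu'] on the positive set; the residual parts [a] and [b] are the Jordan parts of the
    difference. *)
Lemma tv_dist_decomp nu nu' :
  exists (k : {measure set E -> \bar R}) (a b : {finite_measure set E -> \bar R}),
  [/\ forall A, measurable A -> nu A = k A + a A,
      forall A, measurable A -> nu' A = k A + b A,
      a [set: E] = (tv_dist nu nu')%:E &
      b [set: E] = (tv_dist nu nu')%:E].
Proof.
have [Ps [N HPN]] := Hahn_decomposition (measure_diff nu nu').
have mP : measurable Ps by case: HPN => -[].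
have mN : measurable N by case: HPN => _ [].
pose a : {finite_measure set E -> \bar R} := jordan_pos HPN.
pose b : {finite_measure set E -> \bar R} := jordan_neg HPN.
pose k : {measure set E -> \bar R} := measure_add (mrestr nu mN) (mrestr nu' mP).
have kE A : k A = nu (A `&` N) + nu' (A `&` Ps) by exact: measure_addE.
have split (m : probability E R) A : measurable A ->
    m A = (fine (m (A `&` N)) + fine (m (A `&` Ps)))%:E.
  move=> mA; rewrite (hahn_decomposition_setC HPN) -fine_probability_setIC//.
  by rewrite fineK// fin_num_measure.
have kfE A : measurable A ->
    k A = (fine (nu (A `&` N)) + fine (nu' (A `&` Ps)))%:E.
  by move=> mA; rewrite kE EFinD !fineK ?fin_num_measure//; exact: measurableI.
exists k, a, b; split; [| |exact: jordan_pos_tv_dist|exact: jordan_neg_tv_dist].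
- move=> A mA; rewrite kfE// split// [a A]jordan_pos_measure_diff//.
  by rewrite -EFinD; congr EFin; lra.
- move=> A mA; rewrite kfE// split// [b A]jordan_neg_measure_diff//.
  by rewrite -EFinD; congr EFin; lra.
Qed.

End tv_dist.

(** * Integration against mixtures, kernels and products *)

Lemma ge0_integral_measureD d (T : measurableType d) (R : realType)
    (m m1 m2 : {measure set T -> \bar R}) (f : T -> \bar R) :
  (forall A, measurable A -> m A = m1 A + m2 A) ->
  (forall x, 0 <= f x) -> measurable_fun [set: T] f ->
  \int[m]_x f x = \int[m1]_x f x + \int[m2]_x f x.
Proof.
move=> mE f0 mf; rewrite -ge0_integral_measure_add//.
by apply: eq_measure_integral => A mA _; rewrite mE// -measure_addE.
Qed.

Lemma integral_bind d d' (X : measurableType d) (Y : measurableType d')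
    (R : realType) (mu : probability X R) (k : R.-pker X ~> Y)
    (m : {measure set Y -> \bar R}) (f : Y -> \bar R) :
  (forall U, measurable U -> m U = \int[mu]_x k x U) ->
  (forall y, 0 <= f y) -> measurable_fun [set: Y] f ->
  \int[m]_y f y = \int[mu]_x \int[k x]_y f y.
Proof.
move=> mE f0 mf.
(* [mu] is regarded as a constant kernel on [unit], which turns the mixture [m] into a composition
   of kernels. *)
have mc : measurable_fun [set: unit] (fun=> mu : pprobability X R).
  exact: measurable_cst.
pose k' := kernel.kernel_snd (T0 := unit) k.
rewrite -[RHS](integral_kcomp (kprobability mc) k' tt f0 mf).
by apply: eq_measure_integral => A mA _; rewrite mE.
Qed.

Section nstep.
Context d (E : measurableType d) (R : realType) (P : R.-pker E ~> E).

Lemma integral_nstep0 (m : {measure set E -> \bar R}) A : measurable A ->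
  \int[m]_y nstep P 0 y A = m A.
Proof. by move=> mA; rewrite -[in RHS](setIT A) -integral_indic.
Qed.

(** Chapman-Kolmogorov; the recursion of [nstep] adds a step at the end, hence the induction on
    [m]. *)
Lemma nstepD n m x A : measurable A ->
  nstep P (n + m) x A = \int[nstep P n x]_y nstep P m y A.
Proof.
move=> mA; elim: m A mA => [|m IH] A mA; first by rewrite addn0 integral_nstep0.
rewrite addnS [LHS]/= /kcomp_noparam.
apply: (integral_bind (mu := nstep_prob P n x) (k := nstep P m)) => //.
exact: measurable_kernel.
Qed.

Lemma invariant_nstep (mu : probability E R) n A :
  invariant_probability P mu -> measurable A ->
  mu A = \int[mu]_x nstep P n x A.
Proof.
move=> inv; elim: n A => [|n IH] A mA; first by rewrite integral_nstep0.
rewrite inv//; apply: (integral_bind (k := nstep P n)) => //.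
exact: measurable_kernel.
Qed.

End nstep.

(** The pointwise bound is integrated over [a \x b]; each marginal integral picks up the factor [r],
    the mass of the other measure. *)
Lemma product_coupling_le d (E : measurableType d) (R : realType)
    (a b : {finite_measure set E -> \bar R}) (r : \bar R)
    (g : E -> \bar R) (D : E * E -> \bar R) :
  a [set: E] = r -> b [set: E] = r ->
  (forall x, 0 <= g x) -> measurable_fun [set: E] g ->
  (forall z, 0 <= D z) -> measurable_fun [set: E * E] D ->
  (forall x y, g x <= g y + D (x, y)) ->
  r * \int[a]_x g x <= r * \int[b]_x g x + \int[a \x b]_z D z.
Proof.
move=> aT bT g0 mg D0 mD gD.
have m1 : measurable_fun [set: E * E] (g \o fst) by exact: measurableT_comp.
have m2 : measurable_fun [set: E * E] (g \o snd) by exact: measurableT_comp.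
have <- : \int[a \x b]_z (g \o fst) z = r * \int[a]_x g x.
  rewrite fubini_tonelli1//= /fubini_F/=.
  rewrite -ge0_integralZl//; last by rewrite -bT.
  by apply: eq_integral => x _; rewrite integral_cst// muleC; congr (_ * _).
have <- : \int[a \x b]_z (g \o snd) z = r * \int[b]_x g x.
  by rewrite fubini_tonelli1//= /fubini_F/= integral_cst// muleC; congr (_ * _).
rewrite -ge0_integralD//; last by move=> z _ /=.
apply: ge0_le_integral => //.
- by move=> z _ /=.
- exact: emeasurable_funD.
- by move=> [x y] _ /=.
Qed.

(** The common part of [nu] and [nu'] cancels; the residual part of [nu] has mass [tv_dist nu nu'],
    and [g] is at most 1. *)
Lemma integral_le_tv_dist d (E : measurableType d) (R : realType)
    (nu nu' : probability E R) (g : E -> \bar R) :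
  (forall x, 0 <= g x <= 1) -> measurable_fun [set: E] g ->
  \int[nu]_x g x <= \int[nu']_x g x + (tv_dist nu nu')%:E.
Proof.
move=> g01 mg; have g0 x : 0 <= g x by case/andP: (g01 x).
have [k [a [b [nuE nuE' aT bT]]]] := tv_dist_decomp nu nu'.
rewrite (ge0_integral_measureD nuE)// (ge0_integral_measureD nuE')// -addeA.
apply: leeD => //; apply: (@le_trans _ _ (tv_dist nu nu')%:E).
  apply: (@le_trans _ _ (\int[a]_x cst 1 x)).
    by apply: ge0_le_integral => // x _; case/andP: (g01 x).
  by rewrite integral_cst// mul1e -aT.
by rewrite leeDr// integral_ge0.
Qed.

(** * Distances between n-step transition probabilities *)

Section nstep_dist.
Context d (E : measurableType d) (R : realType) (P : R.-pker E ~> E).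

Definition nstep_dist n (z : E * E) : R :=
  tv_dist (nstep_prob P n z.1) (nstep_prob P n z.2).

Let nstep_itv n x A : measurable A -> 0 <= nstep P n x A <= 1.
Proof.
move=> mA; rewrite measure_ge0/= -/(nstep_prob P n x A).
exact: probability_le1.
Qed.

Lemma nstep_dist_itv n z : (0 <= nstep_dist n z <= 1)%R.
Proof. by rewrite tv_dist_ge0 tv_dist_le1. Qed.

(** One further step integrates [P ^~ A], with values in [0,1], against the laws at time [n], so
    [integral_le_tv_dist] applies. *)
Lemma nstep_dist_nonincreasing z : nonincreasing_seq (nstep_dist ^~ z).
Proof.
apply/nonincreasing_seqP => n; apply: tv_dist_le => A mA.
rewrite lerBlDl -lee_fin EFinD !fineK ?fin_num_measure//.
apply: (@integral_le_tv_dist _ _ _ (nstep_prob P n z.1) (nstep_prob P n z.2)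
  (P ^~ A)); last exact: measurable_kernel.
move=> x; rewrite measure_ge0/= -(prob_kernel (s := P) x).
by apply: le_measure; rewrite ?inE.
Qed.

Lemma nstep_le n x y A : measurable A ->
  nstep P n x A <= nstep P n y A + (nstep_dist n (x, y))%:E.
Proof.
move=> mA; have nE w : nstep P n w A = nstep_prob P n w A by [].
rewrite !nE -(fineK (fin_num_measure (nstep_prob P n x) _ mA)).
rewrite -(fineK (fin_num_measure (nstep_prob P n y) _ mA)).
by rewrite -EFinD lee_fin -lerBlDl; exact: tv_dist_ub.
Qed.

(** By Chapman-Kolmogorov the integrals of [nstep P m y A] in [y] against [k] cancel, and
    [product_coupling_le] bounds the difference of those against [a] and [b]. The left side carries
    the factor [r] because [a \x b] has mass [r * r], whereas a coupling of [a] and [b] has mass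
    [r]. *)
Lemma nstep_dist_coupling n m x y (k : {measure set E -> \bar R})
    (a b : {finite_measure set E -> \bar R}) (r : R) :
  measurable_fun [set: E * E] (nstep_dist m) ->
  (forall A, measurable A -> nstep P n x A = k A + a A) ->
  (forall A, measurable A -> nstep P n y A = k A + b A) ->
  a [set: E] = r%:E -> b [set: E] = r%:E ->
  (r * nstep_dist (n + m) (x, y))%:E <= \int[a \x b]_z (nstep_dist m z)%:E.
Proof.
move=> mD xE yE aT bT.
have r0 : (0 <= r)%R by rewrite -lee_fin -aT.
have X0 : 0 <= \int[a \x b]_z (nstep_dist m z)%:E.
  by apply: integral_ge0 => z _; rewrite lee_fin; case/andP: (nstep_dist_itv m z).
move XE : (\int[a \x b]_z (nstep_dist m z)%:E) X0 => [X| |]//; last first.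
  by move=> _; rewrite leey.
rewrite lee_fin => X0.
suff h A : measurable A -> (r * (fine (nstep P (n + m) x A) -
    fine (nstep P (n + m) y A)) <= X)%R.
  move: r0; rewrite le_eqVlt => /predU1P[<-|r0]; first by rewrite mul0r.
  rewrite lee_fin mulrC -ler_pdivlMr//; apply: tv_dist_le => A mA.
  by rewrite ler_pdivlMr// mulrC; exact: h.
move=> mA; pose g y := nstep P m y A.
have g0 z : 0 <= g z by [].
have mg : measurable_fun [set: E] g by exact: measurable_kernel.
have gD u v : g u <= g v + (nstep_dist m (u, v))%:E by exact: nstep_le.
have D0 z : 0 <= (nstep_dist m z)%:E.
  by rewrite lee_fin; case/andP: (nstep_dist_itv m z).
have mDE : measurable_fun [set: E * E] (fun z => (nstep_dist m z)%:E).
  exact/measurable_EFinP.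
have := product_coupling_le aT bT g0 mg D0 mDE gD.
(* As [g] is at most 1, its integrals against finite measures are real; so is the one against [k],
   being a summand of such an integral, and it can be subtracted. *)
have fin (l : {finite_measure set E -> \bar R}) : \int[l]_x g x \is a fin_num.
  rewrite ge0_fin_numE ?integral_ge0//.
  apply: (@le_lt_trans _ _ (\int[l]_x cst 1 x)).
    by apply: ge0_le_integral => // z _; case/andP: (nstep_itv m z mA).
  by rewrite integral_cst// mul1e -ge0_fin_numE// fin_num_measure.
have int_nstep w (l : {finite_measure set E -> \bar R}) :
    (forall A, measurable A -> nstep P n w A = k A + l A) ->
    fine (nstep P (n + m) w A) = (fine (\int[k]_x g x) + fine (\int[l]_x g x))%R.
  move=> lE; rewrite nstepD// (ge0_integral_measureD lE)// fineD//;
    last exact: fin.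
  have : \int[nstep_prob P n w]_x g x \is a fin_num by exact: fin.
  by rewrite (ge0_integral_measureD lE)// fin_numD => /andP[].
rewrite XE (int_nstep _ _ xE) (int_nstep _ _ yE).
rewrite -(fineK (fin a)) -(fineK (fin b)) -!EFinM -EFinD lee_fin.
lra.
Qed.

End nstep_dist.

(** Countable generation enters here: the supremum over all measurable sets becomes one over a
    countable family that does not depend on [z]. *)
Lemma measurable_nstep_dist d (E : measurableType d) (R : realType)
    (P : R.-pker E ~> E) n : countably_generated E ->
  measurable_fun [set: E * E] (nstep_dist P n).
Proof.
move=> /(@countably_generated_dense _ _ R)[A [mA dA]].
have -> : nstep_dist P n = fun z => sups (fun k =>
    fine (nstep P n z.1 (A k)) - fine (nstep P n z.2 (A k)))%R 0%N.
  apply/funext => z; rewrite /nstep_dist (tv_dist_dense _ _ mA dA).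
  rewrite /sups/= /sdrop; congr sup.
  apply/seteqP; split=> [_ [k _ <-]|_ [k _ <-]]; by exists k.
have mP B : measurable B -> measurable_fun [set: E] (fun x => fine (nstep P n x B)).
  by move=> mB; apply: measurableT_comp => //; exact: measurable_kernel.
apply: measurable_fun_sups.
  move=> z _; exists 1%R => _ [k _ <-].
  apply: le_trans (tv_dist_le1 (nstep_prob P n z.1) (nstep_prob P n z.2)).
  exact: (@tv_dist_ub _ _ _ (nstep_prob P n z.1) (nstep_prob P n z.2)).
move=> k; apply: measurable_funB; exact: measurableT_comp (mP _ (mA k)) _.
Qed.

(** * Bounded convergence and functions constant along a kernel *)

Lemma bounded_integrable d (T : measurableType d) (R : realType)
    (m : {measure set T -> \bar R}) (f : T -> R) (b : R) :
  m [set: T] < +oo -> measurable_fun [set: T] f ->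
  (forall x, `|f x| <= b)%R -> m.-integrable [set: T] (EFin \o f).
Proof.
move=> mT mf fb; apply: measurable_bounded_integrable => //.
exists b; split; first by rewrite num_real.
by move=> c /ltW bc x _; exact: le_trans (fb x) bc.
Qed.

Lemma bounded_cvg_integral d (T : measurableType d) (R : realType)
    (m : {measure set T -> \bar R}) (f_ : (T -> R)^nat) (f : T -> R) :
  m [set: T] < +oo -> (forall n, measurable_fun [set: T] (f_ n)) ->
  (forall n x, 0 <= f_ n x <= 1)%R -> (forall x, f_ ^~ x @ \oo --> f x) ->
  (\int[m]_x (f_ n x)%:E) @[n --> \oo] --> \int[m]_x (f x)%:E.
Proof.
move=> mT mf f01 cf.
have [] // := @dominated_convergence _ T R m _ measurableT
  (fun n x => (f_ n x)%:E) (fun x => (f x)%:E) (cst 1).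
- by move=> n; exact/measurable_EFinP.
- by apply/measurable_EFinP; exact: measurable_fun_cvg mf _.
- by apply: aeW => x _; apply: cvg_EFin; [exact: nearW|exact: cf].
- apply: (@bounded_integrable _ _ _ _ (cst 1%R) 1%R) => // x.
  by rewrite /= normr1.
- apply: aeW => x n _; rewrite lee_fin.
  by case/andP: (f01 n x) => h0 h1; rewrite ger0_norm.
Qed.

(* Expanding the square, the variance of [f] under [Q z] around [f z] is at most
   [\int f^2 dQ(z) - f(z)^2], whose integral against [M] vanishes. *)
Section ae_constant.
Context d (T : measurableType d) (R : realType).
Variables (M : {measure set T -> \bar R}) (Q : T -> {measure set T -> \bar R}).
Variable f : T -> R.
Hypotheses (Mfin : M [set: T] < +oo) (Q1 : forall z, Q z [set: T] = 1).
Hypotheses (mf : measurable_fun [set: T] f) (f01 : forall z, (0 <= f z <= 1)%R).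
Hypothesis subinv : forall z, (f z)%:E <= \int[Q z]_w (f w)%:E.
Hypothesis mQ : measurable_fun [set: T] (fun z => \int[Q z]_w ((f w) ^+ 2)%:E).
Hypothesis QM : \int[M]_z \int[Q z]_w ((f w) ^+ 2)%:E = \int[M]_z ((f z) ^+ 2)%:E.

Let Qfin z : Q z [set: T] < +oo. Proof. by rewrite Q1 ltry. Qed.

Let f2 z : (0 <= f z ^+ 2 <= 1)%R.
Proof. by case/andP: (f01 z) => f0 f1; rewrite sqr_ge0 expr_le1. Qed.

Let mf2 : measurable_fun [set: T] (fun z => f z ^+ 2)%R.
Proof. exact: measurable_funX. Qed.

Let int_f2 (m : {measure set T -> \bar R}) :
  m [set: T] < +oo -> m.-integrable [set: T] (EFin \o (fun z => f z ^+ 2)%R).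
Proof.
move=> mT; apply: (@bounded_integrable _ _ _ _ _ 1%R) => // x.
by case/andP: (f2 x) => ? ?; rewrite ger0_norm.
Qed.

Let int_f (m : {measure set T -> \bar R}) :
  m [set: T] < +oo -> m.-integrable [set: T] (EFin \o f).
Proof.
move=> mT; apply: (@bounded_integrable _ _ _ _ _ 1%R) => // x.
by case/andP: (f01 x) => ? ?; rewrite ger0_norm.
Qed.

Let H z : R := fine (\int[Q z]_w ((f w) ^+ 2)%:E).
Let F z : R := fine (\int[Q z]_w (f w)%:E).

Let HE z : \int[Q z]_w ((f w) ^+ 2)%:E = (H z)%:E.
Proof. by rewrite fineK//; exact: integrable_fin_num (int_f2 (Qfin z)). Qed.

Let FE z : \int[Q z]_w (f w)%:E = (F z)%:E.
Proof. by rewrite fineK//; exact: integrable_fin_num (int_f (Qfin z)). Qed.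

Let variance z : \int[Q z]_w ((f w - f z) ^+ 2)%:E =
  (H z - 2 * f z * F z + f z ^+ 2)%:E.
Proof.
transitivity (\int[Q z]_w (((f w) ^+ 2)%:E +
    ((- 2 * f z)%:E * (f w)%:E + (f z ^+ 2)%:E))).
  by apply: eq_integral => w _; rewrite -EFinM -!EFinD; congr EFin; ring.
have i1 := int_f2 (Qfin z).
have i2 : (Q z).-integrable [set: T] (fun w => (- 2 * f z)%:E * (f w)%:E).
  by apply: integrableZl => //; exact: int_f.
have i3 : (Q z).-integrable [set: T] (cst (f z ^+ 2)%:E).
  by apply: (@bounded_integrable _ _ _ _ (cst (f z ^+ 2)%R) `|f z ^+ 2|%R).
rewrite integralD//; last exact: integrableD.
rewrite integralD// integralZl//; last exact: int_f.
rewrite integral_cst// Q1 mule1 HE FE -EFinM -!EFinD; congr EFin; ring.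
Qed.

Let F_ge z : (f z <= F z)%R.
Proof. by rewrite -lee_fin -FE. Qed.

(** Nonnegativity of the variance gives [H z >= 2 * f z * F z - f z ^+ 2], and subinvariance gives
    [F z >= f z >= 0]. *)
Let H_ge z : (f z ^+ 2 <= H z)%R.
Proof.
have : 0 <= \int[Q z]_w ((f w - f z) ^+ 2)%:E.
  by apply: integral_ge0 => w _; rewrite lee_fin sqr_ge0.
rewrite variance lee_fin => h.
have := F_ge z; case/andP: (f01 z) => f0 _; nra.
Qed.

Lemma ae_variance0 : \forall z \ae M, \int[Q z]_w ((f w - f z) ^+ 2)%:E = 0.
Proof.
have mH : measurable_fun [set: T] H.
  by apply: measurableT_comp mQ.
have H01 z : (`|H z| <= 1)%R.
  rewrite ger0_norm; last by apply: le_trans (H_ge z); rewrite sqr_ge0.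
  rewrite -lee_fin -HE -(Q1 z) -[leRHS]mul1e -integral_cst//.
  apply: ge0_le_integral => //.
  - by move=> w _; rewrite lee_fin sqr_ge0.
  - exact/measurable_EFinP.
  - by move=> w _; rewrite lee_fin; case/andP: (f2 w).
have iH : M.-integrable [set: T] (EFin \o H) by exact: bounded_integrable H01.
have : \int[M]_z `|(H z)%:E - (f z ^+ 2)%:E| = 0.
  transitivity (\int[M]_z ((H z)%:E - (f z ^+ 2)%:E)).
    by apply: eq_integral => z _; rewrite gee0_abs// -EFinB lee_fin subr_ge0.
  rewrite integralB_EFin//; last exact: int_f2.
  under eq_integral do rewrite -HE.
  by rewrite QM subee//; exact: integrable_fin_num (int_f2 Mfin).
have mHf : measurable_fun [set: T] (fun z => (H z)%:E - (f z ^+ 2)%:E).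
  by apply: emeasurable_funB; exact/measurable_EFinP.
move/(ae_eq_integral_abs _ measurableT mHf); apply: filterS => z /(_ I).
rewrite -EFinB => -[HfE].
apply/eqP; rewrite eq_le; apply/andP; split; last first.
  by apply: integral_ge0 => w _; rewrite lee_fin sqr_ge0.
(* With [H z = f z ^+ 2] the variance is [2 * f z * (f z - F z)], which is nonpositive. *)
rewrite variance lee_fin.
have := F_ge z; case/andP: (f01 z) => f0 _; nra.
Qed.

End ae_constant.

(** * Two independent copies of the chain *)

Section product_nstep.
Context d (E : measurableType d) (R : realType) (P : R.-pker E ~> E).
Variables (n : nat) (g : E * E -> \bar R).
Hypotheses (g0 : forall z, 0 <= g z) (mg : measurable_fun [set: E * E] g).

(** [phi] averages over [n] steps of the second coordinate and [G] then over those of the first, so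
    that measurability and invariance can be treated one coordinate at a time. *)
Let phi (z : E * E) := \int[nstep_prob P n z.2]_y g (z.1, y).
Let G (z : E * E) := \int[nstep_prob P n z.1]_x phi (x, z.2).

Let phi0 z : 0 <= phi z. Proof. exact: integral_ge0. Qed.

Let mphi : measurable_fun [set: E * E] phi.
Proof.
apply: (measurable_fun_integral_sfinite_kernel
  (fun u : (E * E) * E => g (u.1.1, u.2))
  (kernel.kernel_snd (T0 := E) (nstep P n))) => //.
apply: measurableT_comp => //; apply: measurable_fun_pair => //.
exact: measurableT_comp.
Qed.

Let mG : measurable_fun [set: E * E] G.
Proof.
(* The coordinates are swapped so that the kernel depends on the second component, as in [mphi]; the
   swap is undone below. *)
have mG' : measurable_fun [set: E * E] (fun z : E * E => G (z.2, z.1)).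
  apply: (measurable_fun_integral_sfinite_kernel
    (fun u : (E * E) * E => phi (u.2, u.1.1))
    (kernel.kernel_snd (T0 := E) (nstep P n))) => //.
  apply: measurableT_comp => //; apply: measurable_fun_pair => //.
  exact: measurableT_comp.
apply: eq_measurable_fun (measurableT_comp mG' (@measurable_swap _ _ E E)).
by move=> [].
Qed.

Let GE z : \int[nstep_prob P n z.1 \x nstep_prob P n z.2]_w g w = G z.
Proof. by rewrite fubini_tonelli1. Qed.

Lemma measurable_integral_product_nstep : measurable_fun [set: E * E]
  (fun z => \int[nstep_prob P n z.1 \x nstep_prob P n z.2]_w g w).
Proof. by apply: eq_measurable_fun mG => z _; rewrite GE. Qed.

Lemma integral_product_nstep (mu mu' : probability E R) :
  invariant_probability P mu -> invariant_probability P mu' ->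
  \int[mu \x mu']_z \int[nstep_prob P n z.1 \x nstep_prob P n z.2]_w g w =
  \int[mu \x mu']_z g z.
Proof.
move=> inv inv'; under eq_integral do rewrite GE.
rewrite fubini_tonelli1//; last by move=> z; exact: integral_ge0.
rewrite [RHS](fubini_tonelli1 g mg g0).
have mS x : measurable_fun [set: E] (fun y => g (x, y)).
  exact: measurableT_comp.
rewrite [RHS](integral_bind (mu := mu) (k := nstep P n)); last 3 first.
- by move=> U mU; exact: invariant_nstep.
- by move=> x; exact: integral_ge0.
- exact: measurable_fun_fubini_tonelli_F.
apply: eq_integral => x _; rewrite /fubini_F.
have mphi' : measurable_fun [set: E * E] (fun u : E * E => phi (u.2, u.1)).
  by apply: measurableT_comp => //; exact: measurable_swap.
(* Invariance of [mu] has been used for the first coordinate. Exchanging the integrals brings [mu']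
   next to the step of the second coordinate, where its own invariance applies. *)
rewrite (fubini_tonelli (m1 := mu') (m2 := nstep_prob P n x)
  (fun u => phi (u.2, u.1)) mphi' (fun u => phi0 _)).
apply: eq_integral => x' _.
by rewrite [RHS](integral_bind (mu := mu') (k := nstep P n))// => U mU;
  exact: invariant_nstep.
Qed.

End product_nstep.

(** [nu] dominates [a] and [nu'] dominates [b], so the factors are enlarged one at a time. Null
    integrals thereby pass from the product of the laws to that of the residual parts. *)
Lemma le_integral_product d (E : measurableType d) (R : realType)
    (nu nu' : probability E R) (k : {measure set E -> \bar R})
    (a b : {finite_measure set E -> \bar R}) (h : E * E -> \bar R) :
  (forall A, measurable A -> nu A = k A + a A) ->
  (forall A, measurable A -> nu' A = k A + b A) ->
  (forall z, 0 <= h z) -> measurable_fun [set: E * E] h ->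
  \int[a \x b]_z h z <= \int[nu \x nu']_z h z.
Proof.
move=> nuE nuE' h0 mh; rewrite !fubini_tonelli1//.
have m1 := measurable_fun_fubini_tonelli_F (m2 := b) h mh h0.
have m2 := measurable_fun_fubini_tonelli_F (m2 := nu') h mh h0.
have F0 (m : {measure set E -> \bar R}) x : 0 <= fubini_F m h x.
  by apply: integral_ge0 => y _; exact: h0.
apply: (@le_trans _ _ (\int[a]_x fubini_F nu' h x)).
  apply: ge0_le_integral => //.
  move=> x _; rewrite /fubini_F (ge0_integral_measureD nuE')//; last first.
    exact: measurableT_comp.
  by rewrite leeDr// integral_ge0.
rewrite (ge0_integral_measureD nuE)//.
  by rewrite leeDr// integral_ge0.
Qed.

Lemma product_measure_setT d (E : measurableType d) (R : realType)
    (a b : {finite_measure set E -> \bar R}) :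
  (a \x b) [set: E * E] = a [set: E] * b [set: E].
Proof. by rewrite -setXTT product_measure1E. Qed.

Lemma product_measure_finite d (E : measurableType d) (R : realType)
    (a b : {finite_measure set E -> \bar R}) : (a \x b) [set: E * E] < +oo.
Proof.
rewrite product_measure_setT -ge0_fin_numE ?mule_ge0//.
by rewrite fin_numM// fin_num_measure.
Qed.

(** * The limiting distance *)

Section lim_dist.
Context d (E : measurableType d) (R : realType) (P : R.-pker E ~> E).
Hypothesis Ecg : countably_generated E.

Definition lim_dist (z : E * E) : R := limn (nstep_dist P ^~ z).

Let mnd n := measurable_nstep_dist P n Ecg.

Let is_cvg_nstep_dist z : cvgn (nstep_dist P ^~ z).
Proof.
apply: nonincreasing_is_cvgn; first exact: nstep_dist_nonincreasing.
by exists 0%R => _ [n _ <-]; case/andP: (nstep_dist_itv P n z).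
Qed.

Lemma cvg_lim_dist z : nstep_dist P ^~ z @ \oo --> lim_dist z.
Proof. exact: is_cvg_nstep_dist. Qed.

Lemma lim_dist_le n z : (lim_dist z <= nstep_dist P n z)%R.
Proof.
apply: nonincreasing_cvgn_ge; first exact: nstep_dist_nonincreasing.
exact: is_cvg_nstep_dist.
Qed.

Lemma lim_dist_itv z : (0 <= lim_dist z <= 1)%R.
Proof.
apply/andP; split.
  apply: limr_ge; first exact: is_cvg_nstep_dist.
  by apply: nearW => n; case/andP: (nstep_dist_itv P n z).
by apply: le_trans (lim_dist_le 0 z) _; case/andP: (nstep_dist_itv P 0 z).
Qed.

Lemma measurable_lim_dist : measurable_fun [set: E * E] lim_dist.
Proof. by apply: measurable_fun_cvg mnd _ => z _; exact: cvg_lim_dist. Qed.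

(** In [nstep_dist_coupling] the decomposition at time [n] stays fixed while [m] tends to infinity:
    the right side converges by dominated convergence, and the left side is at least its value at
    the limit. *)
Lemma lim_dist_coupling n x y (k : {measure set E -> \bar R})
    (a b : {finite_measure set E -> \bar R}) (r : R) :
  (forall A, measurable A -> nstep P n x A = k A + a A) ->
  (forall A, measurable A -> nstep P n y A = k A + b A) ->
  a [set: E] = r%:E -> b [set: E] = r%:E ->
  (r * lim_dist (x, y))%:E <= \int[a \x b]_z (lim_dist z)%:E.
Proof.
move=> xE yE aT bT.
have r0 : (0 <= r)%R by rewrite -lee_fin -aT.
have h : (\int[a \x b]_z (nstep_dist P m z)%:E) @[m --> \oo] -->
         \int[a \x b]_z (lim_dist z)%:E.
  apply: bounded_cvg_integral => //.
  - exact: product_measure_finite.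
  - exact: nstep_dist_itv.
rewrite -(cvg_lim _ h)//; apply: lime_ge; first exact: cvgP h.
apply: nearW => m; apply: le_trans (nstep_dist_coupling (mnd m) xE yE aT bT).
by rewrite lee_fin ler_wpM2l// lim_dist_le.
Qed.

End lim_dist.

(** * Vanishing of the limiting distance, uniqueness and convergence *)

Section main.
Context d (E : measurableType d) (R : realType) (P : R.-pker E ~> E).
Hypothesis Ecg : countably_generated E.
Hypothesis PP : forall x y : E, exists n : nat, (0 < n)%N /\
  ~ singular (nstep_prob P n x) (nstep_prob P n y).

Let f := lim_dist P.
Let mf : measurable_fun [set: E * E] f := measurable_lim_dist P Ecg.
Let f0 z : (0 <= f z)%R. Proof. by case/andP: (lim_dist_itv P z). Qed.

Let Q n z := nstep_prob P n z.1 \x nstep_prob P n z.2.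

Lemma lim_dist_eq0 z :
  (forall n, \int[Q n z]_w ((f w - f z) ^+ 2)%:E = 0) -> f z = 0%R.
Proof.
case: z => x y H; set c := f (x, y).
have [n [_ nsing]] := PP x y.
pose r := nstep_dist P n (x, y).
have /andP[r0 r1] : (0 <= r <= 1)%R := nstep_dist_itv P n (x, y).
have r_neq1 : r != 1%R by apply/eqP => /singular_tv_dist.
have [k [a [b [xE yE aT bT]]]] :=
  tv_dist_decomp (nstep_prob P n x) (nstep_prob P n y).
have mh : measurable_fun [set: E * E] (fun w => ((f w - c) ^+ 2)%:E).
  by apply/measurable_EFinP; apply: measurable_funX; exact: measurable_funB.
have h0 w : 0 <= ((f w - c) ^+ 2)%:E by rewrite lee_fin sqr_ge0.
(* The variance integral vanishes against the product of the two laws, hence against [a \x b], which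
   that product dominates. *)
have fc : ae_eq (a \x b) setT (EFin \o f) (cst c%:E).
  have : \int[a \x b]_w `|((f w - c) ^+ 2)%:E| = 0.
    under eq_integral do rewrite gee0_abs//.
    apply/eqP; rewrite eq_le integral_ge0// andbT.
    by apply: le_trans (le_integral_product xE yE h0 mh) _; rewrite H.
  move/(ae_eq_integral_abs _ measurableT mh); apply: filterS => w /(_ I)[].
  by move=> /eqP; rewrite sqrf_eq0 subr_eq0 => /eqP /= ->.
(* The mass of [a \x b] is [r * r]; the second factor [r] is what forces [c] to vanish. *)
have fint : \int[a \x b]_w (f w)%:E = (c * (r * r))%:E.
  rewrite (ae_eq_integral (cst c%:E))//; last exact/measurable_EFinP.
  rewrite integral_cst// EFinM; congr (_ * _).
  by apply: etrans (product_measure_setT a b) _; rewrite aT bT.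
have := lim_dist_coupling Ecg xE yE aT bT.
rewrite fint lee_fin -/f -/c -/r => rc.
have c0 : (0 <= c)%R := f0 _.
have cr : (c <= r)%R := lim_dist_le P n (x, y).
apply/eqP; rewrite eq_le c0 andbT.
have r_lt1 : (r < 1)%R by rewrite lt_neqAle r_neq1.
(* For [r = 0] the bound [c <= r] suffices; otherwise dividing [rc] by [r] gives [c <= c * r] with
   [r < 1]. *)
have [r00|rpos] := eqVneq r 0%R; first by rewrite -r00.
have rp : (0 < r)%R by rewrite lt_neqAle eq_sym rpos.
have : (c <= c * r)%R by rewrite -(ler_pM2l rp) mulrCA.
nra.
Qed.

Lemma integral_lim_dist (mu mu' : probability E R) :
  invariant_probability P mu -> invariant_probability P mu' ->
  \int[mu \x mu']_z (f z)%:E = 0.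
Proof.
move=> inv inv'.
have g0 w : 0 <= ((f w) ^+ 2)%:E by rewrite lee_fin sqr_ge0.
have mg : measurable_fun [set: E * E] (fun w => ((f w) ^+ 2)%:E).
  by apply/measurable_EFinP; exact: measurable_funX.
have Q1 n z : Q n z [set: E * E] = 1.
  apply: etrans (product_measure_setT _ _) _; rewrite -[RHS]mule1.
  by congr (_ * _); exact: probability_setT.
have subinv n z : (f z)%:E <= \int[Q n z]_w (f w)%:E.
  case: z => x y.
  (* Independent copies are the coupling with zero common part: the residual parts are the full
     laws, of mass 1. *)
  have := @lim_dist_coupling _ _ _ P Ecg n x y mzero
    (nstep_prob P n x) (nstep_prob P n y) 1%R.
  rewrite mul1r; apply.
  - by move=> A mA; rewrite /mzero/= add0e.
  - by move=> A mA; rewrite /mzero/= add0e.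
  - exact: probability_setT.
  - exact: probability_setT.
have ae n : \forall z \ae mu \x mu', \int[Q n z]_w ((f w - f z) ^+ 2)%:E = 0.
  apply: ae_variance0 => //.
  - exact: product_measure_finite.
  - exact: Q1.
  - exact: lim_dist_itv.
  - exact: subinv.
  - exact: measurable_integral_product_nstep.
  - exact: integral_product_nstep.
rewrite (ae_eq_integral (cst 0))//; [by rewrite integral0|exact/measurable_EFinP|].
(* The time provided by [PP] depends on [z], so the exceptional sets for all [n] are discarded
   together. *)
move/ae_foralln : ae; apply: filterS => z H _ /=.
by rewrite lim_dist_eq0.
Qed.

Let cvg_integral_nstep_dist d' (T : measurableType d')
    (m : {measure set T -> \bar R}) (u : T -> E * E) :
  m [set: T] < +oo -> measurable_fun [set: T] u ->
  (\int[m]_t (nstep_dist P n (u t))%:E) @[n --> \oo] --> \int[m]_t (f (u t))%:E.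
Proof.
move=> mT mu; apply: bounded_cvg_integral => //.
- by move=> n; apply: measurableT_comp mu; exact: measurable_nstep_dist.
- by move=> n t; exact: nstep_dist_itv.
- by move=> t; exact: cvg_lim_dist.
Qed.

(** For each [n] the excess of [mu A] over [mu' A] is at most the integral of [nstep_dist P n] over
    [mu \x mu'], which tends to that of [lim_dist P], namely 0. Exchanging [mu] and [mu'] then gives
    equality. *)
Lemma invariant_le (mu mu' : probability E R) A :
  invariant_probability P mu -> invariant_probability P mu' ->
  measurable A -> mu A <= mu' A.
Proof.
move=> inv inv' mA.
have h : (mu' A + \int[mu \x mu']_z (nstep_dist P n z)%:E) @[n --> \oo] --> mu' A.
  rewrite -[X in _ --> X]adde0 -(integral_lim_dist inv inv').
  apply: cvgeD; first by rewrite integral_lim_dist// fin_num_adde_defl.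
    exact: cvg_cst.
  by apply: (cvg_integral_nstep_dist (u := id)) => //; exact: product_measure_finite.
rewrite -(cvg_lim _ h)//; apply: lime_ge; first exact: cvgP h.
apply: nearW => n; rewrite (invariant_nstep n inv mA) (invariant_nstep n inv' mA).
rewrite -[leLHS]mul1e -[X in X + _]mul1e; apply: product_coupling_le.
- exact: probability_setT.
- exact: probability_setT.
- by [].
- exact: measurable_kernel.
- by move=> z; rewrite lee_fin; case/andP: (nstep_dist_itv P n z).
- by apply/measurable_EFinP; exact: measurable_nstep_dist.
- by move=> x y; exact: nstep_le.
Qed.

(** Invariance writes [mu] as the average of [nstep_prob P n y] over [y], so [nstep_le] can be
    integrated in [y]. *)
Lemma tv_dist_invariant_le (mu : probability E R) n x :
  invariant_probability P mu ->
  (tv_dist (nstep_prob P n x) mu)%:E <= \int[mu]_y (nstep_dist P n (x, y))%:E.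
Proof.
move=> inv.
have D0 y : 0 <= (nstep_dist P n (x, y))%:E.
  by rewrite lee_fin; case/andP: (nstep_dist_itv P n (x, y)).
have mD : measurable_fun [set: E] (fun y => (nstep_dist P n (x, y))%:E).
  apply/measurable_EFinP; apply: (measurableT_comp (measurable_nstep_dist P n Ecg)).
  exact: measurable_fun_pair.
have le A : measurable A ->
    nstep_prob P n x A <= mu A + \int[mu]_y (nstep_dist P n (x, y))%:E.
  move=> mA; rewrite (invariant_nstep n inv mA) -ge0_integralD//;
    last exact: measurable_kernel.
  rewrite -[leLHS]mule1 -(probability_setT mu) -integral_cst//.
  apply: ge0_le_integral => //.
  - by apply: emeasurable_funD => //; exact: measurable_kernel.
  - by move=> y _; exact: nstep_le.
move XE : (\int[mu]_y _) le => [X| |] le; last 2 first.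
- by rewrite leey.
- by have : 0 <= -oo :> \bar R by rewrite -XE integral_ge0.
rewrite lee_fin; apply: tv_dist_le => A mA.
rewrite lerBlDl -lee_fin EFinD !fineK ?fin_num_measure//.
exact: le.
Qed.

End main.

Unset Implicit Arguments.

Theorem corollary1 (R : realType) (d : measure_display) (E : measurableType d)
    (P : R.-pker E ~> E)
    (Ecg : countably_generated E)
    (Ediag : measurable (@diagonal E))
    (PP : forall x y : E, exists n : nat, (0 < n)%N /\
      ~ singular (nstep_prob P n x) (nstep_prob P n y)) :
  (forall mu mu' : probability E R,
      invariant_probability P mu -> invariant_probability P mu' ->
      forall A : set E, measurable A -> mu A = mu' A) /\
  (forall mu : probability E R, invariant_probability P mu ->
      \forall x \ae mu,
        total_variation_norm (measure_diff (nstep_prob P n x) mu)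
          @[n --> \oo] --> 0).
Proof.
split=> [mu mu' inv inv' A mA|mu inv].
  by apply/eqP; rewrite eq_le !(invariant_le Ecg PP).
have mf := measurable_lim_dist P Ecg.
have muT : mu [set: E] < +oo by rewrite probability_setT ltry.
have f0 z : 0 <= (lim_dist P z)%:E by rewrite lee_fin; case/andP: (lim_dist_itv P z).
have mfE : measurable_fun [set: E * E] (fun z => (lim_dist P z)%:E).
  exact/measurable_EFinP.
(* By Tonelli, the vanishing double integral leaves, for almost every [x], a vanishing integral over
   [y]. *)
have := integral_lim_dist Ecg PP inv inv.
rewrite (fubini_tonelli1 _ mfE f0).
have mF := measurable_fun_fubini_tonelli_F (m2 := mu) _ mfE f0.
have F0 x : 0 <= fubini_F mu (fun z => (lim_dist P z)%:E) x.
  by apply: integral_ge0 => y _; exact: f0.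
under eq_integral do rewrite -(gee0_abs (F0 _)).
move/(ae_eq_integral_abs _ measurableT mF); apply: filterS => x /(_ I) /= Fx.
have h : (\int[mu]_y (nstep_dist P n (x, y))%:E) @[n --> \oo] --> 0.
  rewrite -Fx; apply: bounded_cvg_integral => //.
  - move=> n; apply: (measurableT_comp (measurable_nstep_dist P n Ecg)).
    exact: measurable_fun_pair.
  - by move=> n y; exact: nstep_dist_itv.
  - by move=> y; exact: cvg_lim_dist.
have h2 : (2%:E * \int[mu]_y (nstep_dist P n (x, y))%:E) @[n --> \oo] --> 0.
  by rewrite -[X in _ --> X](mule0 2%:E); apply: cvgeZl.
apply: (squeeze_cvge _ (cvg_cst 0) h2).
apply: nearW => n; rewrite total_variation_norm_tv_dist EFinM.
apply/andP; split; first by rewrite -EFinM lee_fin mulr_ge0 ?tv_dist_ge0.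
by apply: lee_wpmul2l; rewrite ?lee_fin//; exact: tv_dist_invariant_le.
Qed.
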